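(* Let $1<\alpha\le 2$. Then the function $$x\mapsto E_{\alpha}(x)+(1+x)E_{\alpha,\alpha}(x)+E_{\alpha,\alpha-1}(x)$$ has no real zeros $x$ with $$|x|\le\frac{(\alpha-1)(\alpha+\Gamma(\alpha))\Gamma(\alpha)}{\alpha(1+\Gamma(\alpha))}.$$
   Context: The one- and two-parameter Mittag-Leffler functions are $E_{\alpha}(z)=\sum_{k=0}^{\infty}\frac{z^{k}}{\Gamma(k\alpha+1)}$ and $E_{\alpha,\beta}(z)=\sum_{k=0}^{\infty}\frac{z^{k}}{\Gamma(k\alpha+\beta)}$. *)

(* Defs.v *)
From mathcomp Require Import all_boot all_order all_algebra.
From mathcomp Require Import all_classical all_reals all_analysis.
Set Implicit Arguments.
Unset Strict Implicit.
Unset Printing Implicit Defensive.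
Import Order.TTheory GRing.Theory Num.Theory.
Import numFieldNormedType.Exports.
Local Open Scope classical_set_scope.
Local Open Scope ring_scope.

(* Euler's integral is only meaningful for 0 < z: for z <= 0 it diverges and
   [Rintegral] returns the junk value 0. *)
Definition Gamma (R : realType) (z : R) : R :=
  Rintegral (@lebesgue_measure R) `]0, +oo[
    (fun t => t `^ (z - 1) * expR (- t)).

(* Both series are [limn] of partial sums, hence only meaningful when they
   converge, which is the case for a, b > 0 and every real x. *)
Definition mittag_leffler (R : realType) (a x : R) : R :=
  limn (series (fun k : nat => x ^+ k / Gamma (k%:R * a + 1))).

Definition mittag_leffler2 (R : realType) (a b x : R) : R :=
  limn (series (fun k : nat => x ^+ k / Gamma (k%:R * a + b))).

(* Main.v *)
Require Import Defs.
From mathcomp Require Import all_boot all_order all_algebra.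
From mathcomp Require Import all_classical all_reals all_analysis.
From mathcomp Require Import measurable_realfun ring lra.
Import Order.TTheory GRing.Theory Num.Theory.
Import numFieldNormedType.Exports.
Local Open Scope ring_scope.

(* Since Gamma (z + 1) = z Gamma z, the coefficients of the four series pair up
   and, with a for alpha, the function is 1 + a / Gamma a + x sum_k c_k x^k where
   c_k = h ((k + 1) a + 1) + h ((k + 2) a) and h s = s / Gamma s. Gamma is
   convex with Gamma 1 = Gamma 2 = 1, hence at most 1 on [1, 2] and nondecreasing
   on [2, +oo[; this gives (a - 1) h (s + a) <= h s for s >= 2. The radius r of
   the statement is at most a - 1, so for -r <= x < 0 the numbers c_k |x|^k are
   nonincreasing and the function is at least 1 + a / Gamma a - r c_0, which is
   positive; for x >= 0 all terms are nonnegative. *)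

(** * Euler's integral: functional equation, finiteness, convexity *)

Section gamma_function.
Set Implicit Arguments.
Unset Strict Implicit.
Context {R : realType}.
Local Notation mu := (@lebesgue_measure R).
Implicit Types (p q t z : R).
Local Open Scope classical_set_scope.

Definition gamma_integrand z t : R := t `^ (z - 1) * expR (- t).

Local Notation gammaf := gamma_integrand.

Lemma gamma_integrand_ge0 z t : 0 <= gammaf z t.
Proof. by rewrite mulr_ge0 ?powR_ge0 ?expR_ge0. Qed.

Lemma measurable_gamma_integrand z (D : set R) :
  measurable_fun D (gammaf z).
Proof.
apply: measurable_funTS; apply: measurable_funM.
  exact: measurable_powR.
by apply: measurableT_comp.
Qed.

Lemma is_derive_gamma_integrand z t : 0 < t ->
  is_derive t 1 (gammaf (z + 1)) (z * gammaf z t - gammaf (z + 1) t).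
Proof.
move=> t0.
have H := is_deriveM (is_derive1_powR z t0)
  (is_derive1_comp (is_derive_expR _) (is_deriveN (is_derive_id t 1))).
have -> : gammaf (z + 1) = (@powR R ^~ z) * (expR \o -%R).
  by apply/funext => s; rewrite /gammaf addrK.
apply: (is_derive_eq H).
change (t `^ z * (expR (- t) * -1) + expR (- t) * (z * t `^ (z - 1)) =
  z * (t `^ (z - 1) * expR (- t)) - t `^ z * expR (- t)).
ring.
Qed.

Lemma continuous_gamma_integrand z (a b : R) : 0 < a ->
  {within `[a, b], continuous (gammaf z)}.
Proof.
move=> a0; apply: derivable_within_continuous => t.
rewrite in_itv/= => /andP[at_ _].
have := is_derive_gamma_integrand (z - 1) (lt_le_trans a0 at_).
by rewrite subrK => H; exact: ex_derive.
Qed.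

Lemma integral_gamma_integrand_segment z (a b : R) : 0 < a -> a < b ->
  (z%:E * \int[mu]_(t in `[a, b]) (gammaf z t)%:E
   = \int[mu]_(t in `[a, b]) (gammaf (z + 1) t)%:E
     + (gammaf (z + 1) b - gammaf (z + 1) a)%:E)%E.
Proof.
move=> a0 ab.
have ig s : mu.-integrable `[a, b] (EFin \o gammaf s).
  apply: continuous_compact_integrable; first exact: segment_compact.
  exact: continuous_gamma_integrand.
have dg s t : a <= t -> derivable (gammaf s) t 1.
  move=> at_; have := is_derive_gamma_integrand (s - 1) (lt_le_trans a0 at_).
  by rewrite subrK => H; exact: ex_derive.
have cg t : a <= t -> {for t, continuous (gammaf (z + 1))}.
  by move=> at_; apply/differentiable_continuous/derivable1_diffP; exact: dg.
have fz1 : (\int[mu]_(t in `[a, b]) (gammaf (z + 1) t)%:E \is a fin_num)%E.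
  by apply: integrable_fin_num => //; exact: ig.
have iz : mu.-integrable `[a, b] (EFin \o (fun t => z * gammaf z t)).
  rewrite (_ : _ \o _ = fun t => z%:E * (EFin \o gammaf z) t)%E//.
  by apply: integrableZl => //; exact: ig.
have := @continuous_FTC2 R (fun t => z * gammaf z t - gammaf (z + 1) t)
  (gammaf (z + 1)) a b ab.
have -> : (\int[mu]_(x in `[a, b]) (z * gammaf z x - gammaf (z + 1) x)%:E =
  z%:E * \int[mu]_(t in `[a, b]) (gammaf z t)%:E -
  \int[mu]_(t in `[a, b]) (gammaf (z + 1) t)%:E)%E.
  under eq_integral do rewrite EFinB.
  rewrite integralB_EFin//.
  congr (_ - _)%E; rewrite -integralZl//; exact: ig.
move=> H; rewrite EFinB -H.
- by rewrite addeC subeK.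
- apply: derivable_within_continuous => t; rewrite in_itv/= => /andP[at_ _].
  by apply: derivableB; [apply: derivableM => //|]; exact: dg.
- split.
  + by move=> t; rewrite in_itv/= => /andP[/ltW at_ _]; exact: dg.
  + by apply: cvg_at_right_filter; exact: cg.
  + by apply: cvg_at_left_filter; apply: cg; exact: ltW.
- move=> t; rewrite in_itv/= => /andP[at_ _].
  rewrite derive1E.
  by have [_] := is_derive_gamma_integrand z (lt_trans a0 at_).
Qed.

Lemma gamma_integrand_cvg_0 z : 0 < z ->
  gammaf (z + 1) n.+1%:R^-1 @[n --> \oo] --> 0.
Proof.
move=> z0.
have H : n.+1%:R^-1 `^ z @[n --> \oo] --> (0 : R).
  have /cvg_at_rightP := @powR_cvg0 R z z0; apply; split.
    by move=> n; rewrite invr_gt0.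
  exact: cvg_harmonic.
apply: (@squeeze_cvgr _ _ _ _ (fun=> 0) (fun n => n.+1%:R^-1 `^ z)) => //.
- apply: nearW => n.
  by rewrite gamma_integrand_ge0 /gammaf addrK ler_piMr ?powR_ge0.
- exact: cvg_cst.
Qed.

(** The boundary term at infinity. With [z - 1 <= k + 1], the bound
    [t ^+ (k + 2) / (k + 2)! <= expR t] leaves at most [(k + 2)! / t]. *)
Lemma gamma_integrand_cvgy z : gammaf z n.+1%:R @[n --> \oo] --> 0.
Proof.
pose k := Num.truncn `|z|.
have zk : z - 1 <= k.+1%:R.
  have /andP[_ /ltW] := truncn_itv (normr_ge0 z).
  have := ler_norm z; rewrite -/k; lra.
have H : k.+2`!%:R * n.+1%:R^-1 @[n --> \oo] --> (0 : R).
  rewrite -[X in _ --> X](mulr0 (k.+2`!%:R)).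
  by apply: cvgMl_tmp; exact: cvg_harmonic.
apply: (@squeeze_cvgr _ _ _ _ (fun=> 0)
  (fun n => k.+2`!%:R * n.+1%:R^-1)) => //.
- apply: nearW => n; rewrite gamma_integrand_ge0 /gammaf /=.
  have n1 : 1 <= n.+1%:R :> R by rewrite ler1n.
  have n0 : 0 < n.+1%:R :> R by rewrite ltr0n.
  rewrite expRN ler_pdivrMr ?expR_gt0// (le_trans (ler_powR n1 zk))//.
  rewrite powR_mulrn ?(ltW n0)//.
  have := @expR_ge1Dxn R n.+1%:R k.+1 (ltW n0).
  set e := expR _ => He.
  have f0 : 0 < k.+2`!%:R :> R by rewrite ltr0n fact_gt0.
  have -> : n.+1%:R ^+ k.+1 =
      k.+2`!%:R / n.+1%:R * (n.+1%:R ^+ k.+2 / k.+2`!%:R) :> R.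
    by rewrite [in RHS]exprS; field; rewrite !gt_eqF.
  rewrite ler_pM2l ?divr_gt0//; lra.
- exact: cvg_cst.
Qed.

(** Extended-real valued, so that the functional equation can be proved first and then used to show
    finiteness. *)
Definition egamma z : \bar R :=
  (\int[mu]_(t in `]0%R, +oo[) (gammaf z t)%:E)%E.

(** Integration by parts on segments that exhaust the half-line: the integrals converge by
    monotonicity and the boundary terms vanish. *)
Lemma egammaD1 z : 0 < z -> (egamma (z + 1) = z%:E * egamma z)%E.
Proof.
move=> z0.
(* Starting from 2 keeps every segment nondegenerate. *)
pose F n : set R := `[n.+2%:R^-1, n.+2%:R].
have F0 n : 0 < n.+2%:R^-1 :> R by rewrite invr_gt0.
have F1 n : n.+2%:R^-1 < n.+2%:R :> R.
  by rewrite (@lt_trans _ _ 1)// ?ltr1n// invf_lt1// ltr1n.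
have FU : `]0%R, +oo[%classic = \bigcup_n F n.
  apply/seteqP; split => t /=; rewrite in_itv/= andbT; last first.
    by move=> [n _]; rewrite /F/= in_itv/= => /andP[+ _]; apply: lt_le_trans.
  move=> t0.
  pose n := maxn (Num.truncn t) (Num.truncn t^-1); exists n => //.
  have /andP[_ h1] := truncn_itv (ltW t0).
  have /andP[_ h2] := truncn_itv (ltW (eqbRL (invr_gt0 t) t0)).
  rewrite /F /= in_itv /=; apply/andP; split.
    rewrite invf_ple ?posrE//; apply: (le_trans (ltW h2)).
    by rewrite ler_nat; apply: leqW; rewrite ltnS leq_maxr.
  apply: (le_trans (ltW h1)).
  by rewrite ler_nat; apply: leqW; rewrite ltnS leq_maxl.
have cvgF s : (\int[mu]_(t in F n) (gammaf s t)%:E @[n --> \oo] --> egamma s)%E.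
  rewrite /egamma FU; apply: ge0_nondecreasing_set_cvg_integral.
  - apply/nondecreasing_seqP => n; rewrite subsetEset; apply: subset_itv.
      by rewrite bnd_simp lef_pV2 ?posrE// ler_nat.
    by rewrite bnd_simp ler_nat.
  - by move=> n; exact: measurable_itv.
  - by move=> n; apply/measurable_EFinP; exact: measurable_gamma_integrand.
  - by move=> n t _; rewrite lee_fin gamma_integrand_ge0.
have cvgB : ((gammaf (z + 1) n.+2%:R - gammaf (z + 1) n.+2%:R^-1)%:E
    @[n --> \oo] --> (0%:E : \bar R))%E.
  apply: cvg_EFin; first exact: nearW.
  rewrite -[X in _ --> X](subr0 0); apply: cvgB.
    have := gamma_integrand_cvgy (z + 1).
    by rewrite -(@cvg_shiftS _ (fun n => gammaf (z + 1) n.+1%:R)).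
  have := gamma_integrand_cvg_0 z0.
  by rewrite -(@cvg_shiftS _ (fun n => gammaf (z + 1) n.+1%:R^-1)).
have H1 : (z%:E * \int[mu]_(t in F n) (gammaf z t)%:E
   @[n --> \oo] --> z%:E * egamma z)%E.
  exact: cvgeZl.
have H2 : (z%:E * \int[mu]_(t in F n) (gammaf z t)%:E
   @[n --> \oo] --> egamma (z + 1))%E.
  under eq_fun do rewrite integral_gamma_integrand_segment//.
  have := cvgeD (@fin_num_adde_defl _ (egamma (z + 1)) 0%:E isT) (cvgF _) cvgB.
  by rewrite adde0; apply.
exact: (cvg_unique _ H2 H1).
Qed.

Lemma egamma1 : egamma 1 = 1%E.
Proof.
rewrite /egamma integral_itv_obnd_cbnd; last first.
  by apply/measurable_EFinP; exact: measurable_gamma_integrand.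
have g1 : gammaf 1 = expR \o -%R.
  by apply/funext => t; rewrite /gammaf subrr powRr0 mul1r.
have dN t : is_derive t 1 (fun s => - expR (- s)) (expR (- t)).
  have H := is_deriveN (is_derive1_comp (is_derive_expR _)
    (is_deriveN (is_derive_id t 1))).
  apply: (is_derive_eq H); rewrite /GRing.scale /=; ring.
have dN' t : derivable (fun s => - expR (- s)) t 1.
  by have := dN t => ?; exact: ex_derive.
have cN : continuous (expR \o (-%R : R -> R)).
  move=> t; apply: continuous_comp; first exact: opp_continuous.
  exact: continuous_expR.
rewrite g1 (@ge0_continuous_FTC2y _ _ (fun t => - expR (- t)) _ 0)//=.
- by rewrite opprK oppr0 expR0 add0e.
- exact: continuous_subspaceT.
- by rewrite -oppr0; apply: cvgN; exact: cvgr_expR.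
- by apply: cvg_at_right_filter; apply: cvgN; exact: cN.
- by move=> t _; rewrite derive1E; have [_ ->] := dN t.
Qed.

(** Positive integers follow from the functional equation, and real [s >= 1] by comparison with
    integers. For any [z > 0], an infinite value at [z] would force one at [z + 1 >= 1]. *)
Lemma egamma_lty z : 0 < z -> (egamma z < +oo)%E.
Proof.
have egamma_ge0 s : (0 <= egamma s)%E.
  by apply: integral_ge0 => t _; rewrite lee_fin gamma_integrand_ge0.
have nat_lty n : (egamma n.+1%:R < +oo)%E.
  elim: n => [|n IH]; first by rewrite egamma1 ltry.
  by rewrite -natr1 egammaD1// lte_mul_pinfty.
have ge1_lty s : 1 <= s -> (egamma s < +oo)%E.
  move=> s1; pose n := Num.truncn s.
  have /andP[_ /ltW sn] := truncn_itv (le_trans ler01 s1).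
  rewrite -/n in sn.
  apply: (@le_lt_trans _ _ (egamma 1 + egamma n.+2%:R)%E); last first.
    by rewrite lte_add_pinfty// egamma1 ltry.
  rewrite /egamma -ge0_integralD//; last first.
  - by apply/measurable_EFinP; exact: measurable_gamma_integrand.
  - by move=> t _; rewrite lee_fin gamma_integrand_ge0.
  - by apply/measurable_EFinP; exact: measurable_gamma_integrand.
  - by move=> t _; rewrite lee_fin gamma_integrand_ge0.
  apply: ge0_le_integral => //.
  - by move=> t _; rewrite lee_fin gamma_integrand_ge0.
  - by apply/measurable_EFinP; exact: measurable_gamma_integrand.
  - apply/measurable_EFinP; apply: measurable_funD.
      exact: measurable_gamma_integrand.
    exact: measurable_gamma_integrand.
  move=> t /=; rewrite in_itv/= andbT => t0.
  (* It remains to bound [t]^ (s - 1)[by]1 + t [^ (n + 1)]: the first term suffices for [t <= 1],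
     the second for [t >= 1]. *)
  rewrite -EFinD lee_fin /gammaf -mulrDl ler_wpM2r ?expR_ge0// subrr powRr0.
  have [t1|/ltW t1] := leP t 1.
    have : t `^ (s - 1) <= t `^ 0 by apply: ger_powR; rewrite ?t0 ?t1 ?subr_ge0.
    rewrite powRr0 => /le_trans; apply; by rewrite lerDl powR_ge0.
  have : t `^ (s - 1) <= t `^ (n.+2%:R - 1).
    apply: ler_powR => //; rewrite lerD2r (le_trans sn)// ler_nat//.
  move=> /le_trans; apply; by rewrite lerDr.
move=> z0; rewrite ltNge leye_eq; apply/negP => /eqP zy.
have := ge1_lty (z + 1); rewrite egammaD1// zy gt0_muley ?lte_fin//.
by rewrite ltxx lerDr (ltW z0) => /(_ isT).
Qed.

Lemma integrable_gamma_integrand z : 0 < z ->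
  mu.-integrable `]0, +oo[ (EFin \o gammaf z).
Proof.
move=> z0; apply/integrableP; split.
  by apply/measurable_EFinP; exact: measurable_gamma_integrand.
under eq_integral do rewrite /= ger0_norm ?gamma_integrand_ge0//.
exact: egamma_lty.
Qed.

Lemma GammaD1 z : 0 < z -> Gamma (z + 1) = z * Gamma z.
Proof.
move=> z0; rewrite /Gamma /Rintegral.
have := egammaD1 z0; rewrite /egamma /gammaf => ->.
rewrite fineM// ge0_fin_numE ?egamma_lty//.
by apply: integral_ge0 => t _; rewrite lee_fin gamma_integrand_ge0.
Qed.

Lemma Gamma1 : Gamma 1 = 1 :> R.
Proof. by have := egamma1; rewrite /Gamma /Rintegral /egamma /gammaf => ->. Qed.

(** For fixed [t] the integrand is the exponential of an affine function of the parameter, hence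
    convex; the inequality is then integrated. *)
Lemma Gamma_convex p q (l : R) : 0 < p -> 0 < q -> 0 <= l <= 1 ->
  Gamma (l * p + (1 - l) * q) <= l * Gamma p + (1 - l) * Gamma q.
Proof.
move=> p0 q0 /andP[l0 l1].
set m := l * p + (1 - l) * q.
have m0 : 0 < m by rewrite /m; nra.
have ip := integrable_gamma_integrand p0.
have iq := integrable_gamma_integrand q0.
have iZ (c : R) s : 0 < s ->
    mu.-integrable `]0, +oo[ (EFin \o (fun t => c * gammaf s t)).
  move=> s0; rewrite (_ : _ \o _ = fun t => c%:E * (EFin \o gammaf s) t)%E//.
  by apply: integrableZl => //; exact: integrable_gamma_integrand.
rewrite /Gamma -!RintegralZl// -RintegralD//; last 2 first.
- exact: iZ.
- exact: iZ.
apply: le_Rintegral => //.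
- exact: integrable_gamma_integrand.
- rewrite (_ : EFin \o _ = (EFin \o (fun t => (l * gammaf p t)%R)) \+
    (EFin \o (fun t => ((1 - l) * gammaf q t)%R)))%E//.
  by apply: integrableD => //; exact: iZ.
move=> t /=; rewrite in_itv/= andbT => t0.
rewrite !mulrA -mulrDl ler_wpM2r ?expR_ge0//.
rewrite /powR !gt_eqF//.
set u := (p - 1) * ln t; set v := (q - 1) * ln t.
have -> : (m - 1) * ln t = l * u + (1 - l) * v by rewrite /m /u /v; ring.
set w := l * u + _.
(* The exponential lies above its tangent at [w]. As [w] is the weighted mean of [u] and [v], the
   linear terms cancel when the two bounds are averaged. *)
have tangent s : expR w * (1 + (s - w)) <= expR s.
  have -> : expR s = expR w * expR (s - w) by rewrite -expRD; congr expR; ring.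
  by rewrite ler_wpM2l ?expR_ge0 ?expR_ge1Dx.
have hu := ler_wpM2l l0 (tangent u).
have l1' : 0 <= 1 - l by rewrite subr_ge0.
have hv := ler_wpM2l l1' (tangent v).
apply: le_trans (lerD hu hv).
have -> : l * (expR w * (1 + (u - w))) + (1 - l) * (expR w * (1 + (v - w))) =
    expR w * (1 + (l * u + (1 - l) * v - w)) by ring.
by rewrite subrr addr0 mulr1.
Qed.

End gamma_function.

(** * Bounds on Gamma, alternating sums, convergence of the series *)

Section gamma_inequalities.
Set Implicit Arguments.
Unset Strict Implicit.
Context {R : realType}.
Implicit Types (a b d s x y z : R).

Lemma Gamma_ge0 z : 0 <= Gamma z.
Proof.
by apply: Rintegral_ge0 => t _; rewrite mulr_ge0 ?powR_ge0 ?expR_ge0.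
Qed.

Local Opaque Gamma.

Lemma Gamma_natS n : Gamma n.+1%:R = n`!%:R :> R.
Proof.
elim: n => [|n IH]; first by rewrite Gamma1 fact0.
by rewrite -natr1 GammaD1 ?ltr0n// IH -natrM factS.
Qed.

Lemma Gamma2 : Gamma 2 = 1 :> R.
Proof. by rewrite (Gamma_natS 1). Qed.

(** With [d = z - y], the point [y] is the mean of [y - 1] and [z] with weights [d / (1 + d)] and
    [1 / (1 + d)]. Convexity and [Gamma (y - 1) <= Gamma y], which holds since [y - 1 >= 1],
    conclude. *)
Lemma Gamma_nondecreasing y z : 2 <= y -> y <= z -> Gamma y <= Gamma z.
Proof.
move=> y2 yz.
have y10 : 0 < y - 1 by lra.
have z0 : 0 < z by lra.
pose d := z - y; have d0 : 0 <= d by rewrite subr_ge0.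
have D0 : 0 < 1 + d by lra.
have l01 : 0 <= d / (1 + d) <= 1.
  by rewrite divr_ge0 ?(ltW D0)//= ler_pdivrMr// mul1r lerDr.
have := Gamma_convex y10 z0 l01.
have Gy : Gamma (y - 1) <= Gamma y.
  have := GammaD1 y10; rewrite subrK => ->.
  by rewrite ler_peMl ?Gamma_ge0//; lra.
have -> : d / (1 + d) * (y - 1) + (1 - d / (1 + d)) * z = y.
  by rewrite /d; field; rewrite gt_eqF.
move: (Gamma y) (Gamma z) (Gamma (y - 1)) Gy => Gy Gz Gy1 Gy1y.
have -> : d / (1 + d) * Gy1 + (1 - d / (1 + d)) * Gz = (d * Gy1 + Gz) / (1 + d).
  by field; rewrite gt_eqF.
rewrite ler_pdivlMr// mulrDr mulr1 (mulrC Gy) => H.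
rewrite -(lerD2r (d * Gy)) [leRHS]addrC; apply: (le_trans H).
by rewrite lerD2r ler_wpM2l.
Qed.

Lemma Gamma_ge1 z : 2 <= z -> 1 <= Gamma z.
Proof. by move=> z2; rewrite -Gamma2; exact: Gamma_nondecreasing. Qed.

Lemma Gamma_gt0 z : 0 < z -> 0 < Gamma z.
Proof.
move=> z0; have z10 : 0 < z + 1 by lra.
have : 0 < Gamma (z + 1 + 1) by apply: lt_le_trans (@Gamma_ge1 _ _) => //; lra.
by rewrite !GammaD1// !pmulr_rgt0.
Qed.

Lemma Gamma_le1 z : 1 <= z <= 2 -> Gamma z <= 1.
Proof.
move=> /andP[z1 z2]; have l01 : 0 <= 2 - z <= 1 by apply/andP; split; lra.
have := Gamma_convex ltr01 (ltr0Sn R 1) l01.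
rewrite Gamma1 Gamma2 !mulr1 subrKC.
by have -> : 2 - z + (1 - (2 - z)) * 2 = z by ring.
Qed.

(** The identity that pairs up the coefficients of the four series. *)
Lemma invGammaD z : 0 < z ->
  (Gamma (z + 1))^-1 + (Gamma z)^-1 = (z + 1) / Gamma (z + 1).
Proof.
move=> z0; rewrite GammaD1//; field.
by rewrite !gt_eqF ?Gamma_gt0.
Qed.

(** Since [Gamma (s + a) >= Gamma (s + 1) = s * Gamma s], it suffices that
    [(a - 1) * (s + a) <= s + 2 <= s ^+ 2]. *)
Lemma divGamma_decay a s : 1 <= a -> a <= 2 -> 2 <= s ->
  (a - 1) * ((s + a) / Gamma (s + a)) <= s / Gamma s.
Proof.
move=> a1 a2 s2.
have s0 : 0 < s by lra.
have G0 := Gamma_gt0 s0.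
have H : s * Gamma s <= Gamma (s + a).
  rewrite -(GammaD1 s0); apply: Gamma_nondecreasing; first by rewrite ler_wpDr.
  by rewrite lerD2l.
have sa0 : 0 < s + a by lra.
have Ga0 := Gamma_gt0 sa0.
move: (Gamma s) (Gamma (s + a)) G0 Ga0 H => Gs Gsa Gs0 Gsa0 H.
rewrite mulrA ler_pdivrMr// mulrAC ler_pdivlMr//.
apply: (@le_trans _ _ (s * (s * Gs))); last by rewrite ler_pM2l.
rewrite mulrA ler_pM2r//; nra.
Qed.

(** Peeling off the first term gives [u 0 - y * S], where the induction hypothesis for the shifted
    sequence yields [0 <= S <= u 1], and [y * u 1 <= r * u 1 <= u 0]. *)
Lemma alternating_sum_bounds (u : nat -> R) r y n :
  (forall k, 0 <= u k) -> (forall k, r * u k.+1 <= u k) -> 0 <= y <= r ->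
  0 <= \sum_(0 <= k < n) (- y) ^+ k * u k <= u 0%N.
Proof.
move=> + + /andP[y0 yr]; elim: n u => [|n IH] u u0 ur.
  by rewrite big_geq// lexx u0.
have /andP[S0 S1] := IH (u \o succn) (fun k => u0 k.+1) (fun k => ur k.+1).
rewrite big_nat_recl//= expr0 mul1r.
under eq_bigr do rewrite exprS -mulrA.
rewrite -big_distrr /=.
set S := \sum_(0 <= i < n) _ in S0 S1 *.
have ur0 := ur 0%N; have u1 := u0 1%N.
rewrite mulNr subr_ge0 lerBlDr lerDl mulr_ge0// andbT.
apply: le_trans ur0; apply: (@le_trans _ _ (y * u 1%N)).
  by rewrite ler_wpM2l.
by rewrite ler_wpM2r.
Qed.

Lemma is_cvg_series_shift (u : nat -> R) :
  cvgn (series (fun k => u k.+1)) -> cvgn (series u).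
Proof.
move=> /cvg_ex[l ul]; apply/cvg_ex; exists (u 0%N + l).
rewrite -cvg_shiftS /series /=.
under eq_fun do rewrite big_nat_recl//.
by apply: cvgD => //; exact: cvg_cst.
Qed.

(** Comparison with the exponential series. Dropping two terms brings the arguments of Gamma to at
    least [k + 2], where monotonicity gives the lower bound [(k + 1)! >= k!]. *)
Lemma is_cvg_mittag_leffler2 a b x : 1 <= a -> 0 <= b ->
  cvgn (series (fun k : nat => x ^+ k / Gamma (k%:R * a + b))).
Proof.
move=> a1 b0; apply: is_cvg_series_shift; apply: is_cvg_series_shift.
apply: normed_cvg.
apply: (@series_le_cvg _ _ (`|x| ^+ 2 *: exp_coeff `|x|)).
- by move=> k; rewrite normr_ge0.
- by move=> k; rewrite mulr_ge0 ?exprn_ge0// exp_coeff_ge0.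
- move=> k; rewrite /= normrM normfV normrX (ger0_norm (Gamma_ge0 _)).
  rewrite -addn2 addnC exprD -mulrA [leRHS]/GRing.scale/=.
  rewrite ler_wpM2l ?exprn_ge0// ler_wpM2l ?exprn_ge0//.
  rewrite lef_pV2 ?posrE ?ltr0n ?fact_gt0//; last first.
    by apply: Gamma_gt0; rewrite ltr_wpDr// mulr_gt0//; lra.
  apply: (@le_trans _ _ (k.+1)`!%:R).
    by rewrite ler_nat factS leq_pmull.
  rewrite -Gamma_natS; apply: Gamma_nondecreasing; first by rewrite ler_nat.
  rewrite add2n; have : 0 <= k.+2%:R :> R by []; nra.
- exact: is_cvg_seriesZ (is_cvg_series_exp_coeff _).
Qed.

End gamma_inequalities.

(** * The paired coefficients and the radius *)

Section coefficients.
Set Implicit Arguments.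
Unset Strict Implicit.
Context {R : realType}.
Variable a : R.
Hypotheses (a_gt1 : 1 < a) (a_le2 : a <= 2).
Implicit Types (b r x : R).
Local Open Scope classical_set_scope.
Local Opaque Gamma.

(* The coefficient of [x ^+ k.+1] in the power series of the function, after
   pairing its four terms by means of [invGammaD]. *)
Definition ml_coef (k : nat) : R :=
  (k.+1%:R * a + 1) / Gamma (k.+1%:R * a + 1) +
  k.+2%:R * a / Gamma (k.+2%:R * a).

Let a_gt0 : 0 < a. Proof. exact: lt_trans ltr01 a_gt1. Qed.

Let natSM_gt0 (k : nat) : 0 < k.+1%:R * a.
Proof. by rewrite mulr_gt0. Qed.

Let natSM (k : nat) : k.+1%:R * a = k%:R * a + a.
Proof. by rewrite -natr1 mulrDl mul1r. Qed.

Lemma ml_coef_ge0 k : 0 <= ml_coef k.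
Proof.
have h0 (s : R) : 0 < s -> 0 <= s / Gamma s.
  by move=> s0; exact: divr_ge0 (ltW s0) (Gamma_ge0 s).
by apply: addr_ge0; apply: h0 => //; rewrite addr_gt0.
Qed.

Lemma ml_coef_decay k : (a - 1) * ml_coef k.+1 <= ml_coef k.
Proof.
have k1 : 1 <= k.+1%:R :> R by rewrite ler1n.
have a1 := a_gt1.
have decay s := @divGamma_decay R a s (ltW a_gt1) a_le2.
have k2 : 2 <= k.+1%:R * a + 1 by nra.
rewrite mulrDr; apply: lerD.
  by rewrite natSM addrAC; exact: decay.
by rewrite [k.+3%:R * a]natSM; apply: decay; rewrite natSM; nra.
Qed.

(** As [Gamma a <= 1], it suffices that [2 * (a - 1) <= Gamma (2 * a)]. For [2 * a <= 3] the left
    side is at most 1; otherwise [Gamma (2 * a) = (2 * a - 1) * Gamma (2 * a - 1) >= 2 * a - 1]. *)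
Let Gamma_double : 2 * (a - 1) * Gamma a * Gamma a <= Gamma (2 * a).
Proof.
have a1 := a_gt1; have g0 := Gamma_ge0 a.
have g1 : Gamma a <= 1 by apply: Gamma_le1; rewrite (ltW a_gt1).
apply: (@le_trans _ _ (2 * (a - 1))).
  move: (Gamma a) g0 g1 => g g0 g1.
  rewrite -mulrA ler_piMr ?mulr_ile1//; lra.
have [a32|a32] := leP (2 * a) 3.
  by apply: le_trans (Gamma_ge1 _); lra.
have a21 : 0 < 2 * a - 1 by lra.
have := GammaD1 a21; rewrite subrK => ->.
have : 1 <= Gamma (2 * a - 1) by apply: Gamma_ge1; lra.
by move: (Gamma _) => G G1; nra.
Qed.

Local Notation radius :=
  ((a - 1) * (a + Gamma a) * Gamma a / (a * (1 + Gamma a))).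

Lemma radius_le : radius <= a - 1.
Proof.
have a1 := a_gt1.
have g1 : Gamma a <= 1 by apply: Gamma_le1; rewrite (ltW a_gt1).
move: (Gamma a) (Gamma_gt0 a_gt0) g1 => g g0 g1.
rewrite ler_pdivrMr ?mulr_gt0 ?addr_gt0// -mulrA.
by rewrite ler_wpM2l ?subr_ge0 ?(ltW a_gt1)//; nra.
Qed.

(** After division by [(a + g) / g], with [g = Gamma a], the claim splits into two bounds against
    [a * g + a]: the first is strict because [a ^+ 2 - 1 < a ^+ 2], the second is [Gamma_double]. *)
Lemma radius_ml_coef0 : radius * ml_coef 0 < 1 + a / Gamma a.
Proof.
have a1 := a_gt1; rewrite /ml_coef !mul1r (GammaD1 a_gt0).
have G20 : 0 < Gamma (2 * a) by apply: Gamma_gt0; rewrite mulr_gt0.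
move: (Gamma a) (Gamma (2 * a)) (Gamma_gt0 a_gt0) G20 Gamma_double.
move=> g G g0 G0 gG.
have ag0 : 0 < a * (1 + g) by rewrite mulr_gt0 ?addr_gt0.
have -> : 1 + a / g = (a + g) / g by field; rewrite gt_eqF.
have -> : (a - 1) * (a + g) * g / (a * (1 + g)) *
      ((a + 1) / (a * g) + 2 * a / G) =
    (a + g) / g * (((a - 1) * (a + 1) / a * g
      + a * (2 * (a - 1) * g * g / G)) / (a * (1 + g))).
  by field; rewrite !gt_eqF ?addr_gt0.
rewrite gtr_pMr; last by rewrite divr_gt0 ?addr_gt0.
rewrite ltr_pdivrMr// mul1r (mulrDr a) mulr1 [ltLHS]addrC; apply: ler_ltD.
  by rewrite ler_piMr ?(ltW a_gt0)// ler_pdivrMr// mul1r.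
rewrite ltr_pM2r// ltr_pdivrMr//; nra.
Qed.

Local Notation S b x := (series (fun k : nat => x ^+ k / Gamma (k%:R * a + b))).

(** The sum multiplied by [x] is one term shorter, so that all four parts stop at degree [n] and the
    identity is exact. *)
Lemma ml_partial_sumE x n :
  S 1 x n.+1 + (S a x n.+1 + x * S a x n) + S (a - 1) x n.+1 =
  1 + a / Gamma a + x * \sum_(0 <= k < n) x ^+ k * ml_coef k.
Proof.
have shift b : S b x n.+1 = (Gamma b)^-1 +
    x * \sum_(0 <= k < n) x ^+ k / Gamma (k.+1%:R * a + b).
  rewrite /series /= big_nat_recl//= expr0 div1r mul0r add0r.
  rewrite big_distrr/=; congr (_ + _); apply: eq_bigr => k _.
  by rewrite exprS mulrA.
have shift1 : S 1 x n.+1 = 1 +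
    x * \sum_(0 <= k < n) x ^+ k / Gamma (k.+1%:R * a + 1).
  by rewrite shift Gamma1 invr1.
have -> : a / Gamma a = (Gamma a)^-1 + (Gamma (a - 1))^-1.
  have a10 : 0 < a - 1 by rewrite subr_gt0.
  by have := invGammaD a10; rewrite subrK => ->.
(* The arguments of Gamma are [(k + 1) a + 1], [(k + 2) a], [(k + 1) a] and [(k + 2) a - 1]; the
   first pairs with the third, the second with the fourth. *)
have -> : \sum_(0 <= k < n) x ^+ k * ml_coef k =
   \sum_(0 <= k < n) x ^+ k / Gamma (k.+1%:R * a + 1) +
   (\sum_(0 <= k < n) x ^+ k / Gamma (k.+1%:R * a + a) + S a x n)
   + \sum_(0 <= k < n) x ^+ k / Gamma (k.+1%:R * a + (a - 1)).
  rewrite /series /= -!big_split /=; apply: eq_bigr => k _.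
  have w0 : 0 < k.+1%:R * a + (a - 1) by rewrite addr_gt0 ?subr_gt0.
  rewrite /ml_coef [k.+2%:R * a]natSM -(invGammaD (natSM_gt0 k)).
  have -> : k.+1%:R * a + a = k.+1%:R * a + (a - 1) + 1 by rewrite -addrA subrK.
  rewrite -(invGammaD w0) -natSM.
  have regroup (p q t u v : R) :
    p * (q + t + (u + v)) = p * q + (p * u + p * t) + p * v by ring.
  exact: regroup.
have regroup (o p q t u v w s1 s2 s3 : R) :
    s1 = o + x * t -> s2 = p + x * u -> s3 = q + x * w ->
    s1 + (s2 + x * v) + s3 = o + (p + q) + x * (t + (u + v) + w).
  by move=> -> -> ->; ring.
exact: regroup shift1 (shift a) (shift (a - 1)).
Qed.

Lemma ml_partial_sum_cvg x :
  S 1 x n.+1 + (S a x n.+1 + x * S a x n) + S (a - 1) x n.+1 @[n --> \oo] -->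
  mittag_leffler a x + (1 + x) * mittag_leffler2 a a x
    + mittag_leffler2 a (a - 1) x.
Proof.
have cvgS b : 0 <= b -> S b x n @[n --> \oo] --> mittag_leffler2 a b x.
  by move=> b0; exact: is_cvg_mittag_leffler2 (ltW a_gt1) b0.
have cvgS' b : 0 <= b -> S b x n.+1 @[n --> \oo] --> mittag_leffler2 a b x.
  by move=> b0; rewrite (@cvg_shiftS _ (S b x)); exact: cvgS.
rewrite mulrDl mul1r; apply: cvgD.
  apply: cvgD; first exact: cvgS'.
  apply: cvgD; first exact: cvgS' (ltW a_gt0).
  by apply: cvgMl_tmp; exact: cvgS (ltW a_gt0).
by apply: cvgS'; rewrite subr_ge0 ltW.
Qed.

(** For [x >= 0] the right side is nonnegative; for [x < 0] the alternating bound applies with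
    [y = - x]. *)
Lemma ml_sum_ge r x n :
  (forall k, r * ml_coef k.+1 <= ml_coef k) -> `|x| <= r ->
  - (r * ml_coef 0) <= x * \sum_(0 <= k < n) x ^+ k * ml_coef k.
Proof.
move=> cr xr.
have r0 : 0 <= r by apply: le_trans xr.
have [x0|x0] := leP 0 x.
  apply: (@le_trans _ _ 0); first by rewrite oppr_le0 mulr_ge0 ?ml_coef_ge0.
  rewrite mulr_ge0// sumr_ge0// => k _.
  by rewrite mulr_ge0 ?exprn_ge0 ?ml_coef_ge0.
have yr : 0 <= - x <= r by rewrite -(ltr0_norm x0) normr_ge0.
have /andP[] := alternating_sum_bounds n ml_coef_ge0 cr yr.
rewrite opprK; set T := \sum_(0 <= k < n) _ => T0 T1.
rewrite lerNl -mulNr; move/andP: yr => [y0 yr].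
exact: ler_pM.
Qed.

End coefficients.

(** * Positivity of the function within the radius *)

Theorem theorem3p6 (R : realType) (alpha : R)
    (alpha_gt1 : 1 < alpha) (alpha_le2 : alpha <= 2) (x : R)
    (x_le : `|x| <= (alpha - 1) * (alpha + Gamma alpha) * Gamma alpha
                    / (alpha * (1 + Gamma alpha))) :
  mittag_leffler alpha x + (1 + x) * mittag_leffler2 alpha alpha x
    + mittag_leffler2 alpha (alpha - 1) x != 0.
Proof.
have c0_lt := radius_ml_coef0 alpha_gt1 alpha_le2.
have := radius_le alpha_gt1 alpha_le2.
set r := (X in _ <= X) in x_le * => r_le.
have c_decay k : r * ml_coef alpha k.+1 <= ml_coef alpha k.
  apply: le_trans (ml_coef_decay alpha_gt1 alpha_le2 k).
  by rewrite ler_wpM2r ?ml_coef_ge0.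
rewrite gt_eqF//.
(* This positive lower bound for the partial sums does not depend on [n], so it survives the
   limit. *)
apply: (@lt_le_trans _ _ (1 + alpha / Gamma alpha - r * ml_coef alpha 0)).
  by rewrite subr_gt0.
apply: (cvgr_to_ge (@ml_partial_sum_cvg R alpha alpha_gt1 x)).
apply: nearW => n.
by rewrite (ml_partial_sumE alpha_gt1) lerD2l ml_sum_ge.
Qed.
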